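(* There exists an absolute constant $C>0$ such that the following holds. Let $w \geq 2$ be an integer and let $M(w) := \max\big(C,\,160(w+1)^2+1\big)$. If $n \geq M(w)$, then there exists a connected graph $G$ on $n$ vertices satisfying the $w$-strong neighbourhood property and having maximum vertex degree \[ \Delta(G) \leq \max\big(10\log(2M(w)),\,8(w+1)\big)+1. \]
   Context: All graphs are finite and simple; $\log$ denotes the natural logarithm. For a vertex $v$, $N(v)$ is the set of vertices adjacent to $v$ (not including $v$), and $N[v] = N(v)\cup\{v\}$; $\#A$ denotes the cardinality of a set $A$. For an integer $k\ge 1$, a graph $G$ has the $k$-strong neighbourhood property if for any two distinct vertices $u,v$ of $G$, $\#\big(N[v]\setminus N[u]\big) \geq k$. *)

(* Defs.v *)
From HB Require Import structures.
From mathcomp Require Import all_boot all_order all_algebra.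
From mathcomp Require Import reals exp.

Set Implicit Arguments.
Unset Strict Implicit.
Unset Printing Implicit Defensive.

Import Order.TTheory GRing.Theory Num.Theory.

Record sgraph (T : finType) := SGraph {
  adj : rel T;
  adj_sym : symmetric adj;
  adj_irr : irreflexive adj }.

Section GraphNotions.
Variables (T : finType) (G : sgraph T).

Definition nbh (v : T) : {set T} := [set u | adj G v u].

Definition cnbh (v : T) : {set T} := v |: nbh v.

Definition strong_nbh_property (k : nat) : Prop :=
  forall u v : T, u != v -> k <= #|cnbh v :\: cnbh u|.

(* Holds vacuously of the graph with no vertices. *)
Definition graph_connected : Prop :=
  forall u v : T, connect (adj G) u v.

Definition max_degree : nat := \max_(v : T) #|nbh v|.

End GraphNotions.

Local Open Scope ring_scope.

Definition Mbound (R : realType) (C : R) (w : nat) : R :=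
  Num.max C (160 * (w%:R + 1) ^+ 2 + 1).

(* Main.v *)
Require Import Defs.
From HB Require Import structures.
From mathcomp Require Import all_boot all_order all_algebra.
From mathcomp Require Import reals exp.
From mathcomp Require Import zify.

Import Order.TTheory GRing.Theory Num.Theory.
Local Open Scope ring_scope.

(** The graph is an explicit circulant graph on Z/n. With L = 2w+1, the vertex x
    is joined to x + a for 0 < |a| <= w and for a = jL with 0 < |j| <= w, so the
    degree is at most 4w. If the cyclic distance T of u and v is at most w, the
    neighbours v + jL on the side of v away from u are not in N[u], because
    0 < T < L. If T > w, the w+1 vertices v, ..., v + w on that side are too far
    from u to be short neighbours, and at most one of them is at a distance
    divisible by L from u. The bound on n excludes wrap-around. *)

Section Circulant.
Local Open Scope nat_scope.

(** On the [n]-cycle the two arcs between [x] and [y] have lengths [dist x y] and [n - dist x y],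
    hence the disjunctions below. *)
Definition dist (x y : nat) : nat := (x - y) + (y - x).

Lemma dist_sym x y : dist x y = dist y x.
Proof. exact: addnC. Qed.

(* [g a] is obtained from [v] by moving [a] steps away from [u] on the cycle. *)
Lemma away_from n u v : u < n -> v < n -> u != v ->
  exists g : nat -> nat, forall a, minn (dist u v) (n - dist u v) + a < n ->
    [/\ g a < n,
        (dist v (g a) == a) || (n - dist v (g a) == a)
      & (dist u (g a) == minn (dist u v) (n - dist u v) + a)
        || (n - dist u (g a) == minn (dist u v) (n - dist u v) + a)].
Proof.
move=> ltu ltv neq_uv.
pose up a := if v + a < n then v + a else v + a - n.
pose dn a := if a <= v then v - a else v + n - a.
(* The shorter arc from [u] to [v] decides whether moving away from [u] is [up] or [dn]. *)
have [d_le|d_gt] := leqP (2 * dist u v) n.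
  have -> : minn (dist u v) (n - dist u v) = dist u v by lia.
  have [ltuv|levu] := ltnP u v; [exists up | exists dn];
    rewrite /dist in d_le * => a lta; rewrite /up /dn; case: ifP => ?; split; lia.
have -> : minn (dist u v) (n - dist u v) = n - dist u v by lia.
have [ltuv|levu] := ltnP u v; [exists dn | exists up];
  rewrite /dist in d_gt * => a lta; rewrite /up /dn; case: ifP => ?; split; lia.
Qed.

Variable w : nat.
Let L := w.*2.+1.

(** The value 0 counts, so that [offset] describes closed neighbourhoods. *)
Definition offset (a : nat) : bool := (a <= w) || (L %| a) && (a <= w * L).

Lemma offset_leq a : offset a -> a <= w * L.
Proof. by rewrite /offset /L => /orP[|/andP[]//]; nia. Qed.

(** This is the choice of private neighbours of [v], freed from the cycle: [T] stands for the
    distance from [u] to [v]. The last disjunction bounds [T + a], which later excludes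
    wrap-around. *)
Lemma offset_escape T : 0 < T ->
  exists s : seq nat, [/\ uniq s, w <= size s &
    forall a, a \in s ->
      [/\ offset a, ~~ offset (T + a) & (a <= w) || (T <= w)]].
Proof.
move=> T_gt0; have [leTw|ltwT] := leqP T w.
  exists [seq j * L | j <- iota 1 w]; split.
  - by rewrite map_inj_uniq ?iota_uniq // => i j /eqP; rewrite eqn_pmul2r // => /eqP.
  - by rewrite size_map size_iota.
  move=> _ /mapP[j + ->]; rewrite mem_iota => jP; split; last by rewrite orbT.
    by rewrite /offset dvdn_mull // leq_mul2r; apply/orP; right; lia.
  rewrite /offset dvdn_addl ?dvdn_mull // negb_or negb_and.
  have ltTL : T < L by rewrite /L; lia.
  by rewrite gtnNdvd // andbT -ltnNge /L; nia.
(* [T + a0] is divisible by [L]; as [w < L], no [a] in [iota 0 w.+1] other than [a0] has this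
   property. *)
pose a0 := (L - T %% L) %% L.
exists (rem a0 (iota 0 w.+1)); split.
- by rewrite rem_uniq ?iota_uniq.
- have := count_rem a0 predT (iota 0 w.+1); rewrite !count_predT size_iota.
  by move=> ->; case: (_ && _) => /=; lia.
move=> a; rewrite rem_filter ?iota_uniq // mem_filter mem_iota /= => /andP[a_neq a_le].
have lea : a <= w by lia.
split; rewrite /offset ?lea // negb_or negb_and; apply/andP; split; first by lia.
apply/orP; left; apply: contra a_neq => dvda.
have ltaL : a < L by rewrite /L; lia.
rewrite /a0 -[X in X == _](modn_small ltaL) -(eqn_modDl (T %% L)).
by rewrite subnKC ?(ltnW (ltn_pmod _ _)) // modnn modnDml.
Qed.

Variable n' : nat.
Let n := n'.+1.

Definition circ_adj (x y : 'I_n) : bool :=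
  (x != y) && (offset (dist x y) || offset (n - dist x y)).

Lemma circ_adj_sym : symmetric circ_adj.
Proof. by move=> x y; rewrite /circ_adj eq_sym dist_sym. Qed.

Lemma circ_adj_irr : irreflexive circ_adj.
Proof. by move=> x; rewrite /circ_adj eqxx. Qed.

Definition circulant : sgraph 'I_n := SGraph circ_adj_sym circ_adj_irr.

(** Consecutive integers are adjacent, as 1 is an offset. *)
Lemma circulant_connected : 0 < w -> graph_connected circulant.
Proof.
move=> w_gt0.
have conn0 (v : 'I_n) : connect circ_adj ord0 v.
  case: v => m; elim: m => [|m IHm] ltm.
    by rewrite (_ : Ordinal ltm = ord0) ?connect0 //; apply: val_inj.
  apply: connect_trans (IHm (ltnW ltm)) (connect1 _).
  rewrite /circ_adj -val_eqE /= /offset /dist.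
  have -> : m - m.+1 + (m.+1 - m) = 1 by lia.
  by rewrite w_gt0 andbT; lia.
move=> u v; apply: connect_trans (conn0 v).
by rewrite (sym_connect_sym circ_adj_sym).
Qed.

(** Each of the at most [2 * w] positive offsets is taken in both directions; a covering list
    suffices, so coincidences are harmless. *)
Lemma circulant_degree (v : 'I_n) : #|nbh circulant v| <= 4 * w.
Proof.
pose offs := iota 1 w ++ [seq j * L | j <- iota 1 w].
have offsP a : 0 < a -> offset a -> a \in offs.
  move=> a_gt0; rewrite mem_cat mem_iota => /orP[lea|]; first by apply/orP; left; lia.
  case/andP=> /dvdnP[j aE]; rewrite {a}aE in a_gt0 *; rewrite leq_pmul2r // => lej.
  by apply/orP; right; apply/map_f; rewrite mem_iota; lia.
pose up a : 'I_n := inord ((v + a) %% n).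
pose dn a : 'I_n := inord ((v + (n - a)) %% n).
suff sub : {subset enum (nbh circulant v) <= map up offs ++ map dn offs}.
  have := uniq_leq_size (enum_uniq _) sub.
  by rewrite -cardE !size_cat !size_map size_cat size_map !size_iota; lia.
(* Before reduction, the sum defining [up] or [dn] is either [x] or [n + x]. *)
have modE (m : nat) (x : 'I_n) : (m == x) || (m == n + x) -> x = inord (m %% n).
  by case/orP=> /eqP ->; rewrite ?modnDl modn_small ?inord_val.
move=> x; rewrite mem_enum inE /= /circ_adj -val_eqE /= mem_cat => /andP[neqvx].
have ltx := ltn_ord x; have ltv := ltn_ord v; have [ltvx|lexv] := ltnP v x.
  case/orP=> dP; apply/orP; [left|right]; apply/mapP; eexists;
    try (by apply: offsP dP; rewrite /dist; lia); by apply: modE; rewrite /dist; lia.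
case/orP=> dP; apply/orP; [right|left]; apply/mapP; eexists;
  try (by apply: offsP dP; rewrite /dist; lia); by apply: modE; rewrite /dist; lia.
Qed.

Lemma circulant_strong : 4 * (w.+1 * L) <= n -> strong_nbh_property circulant w.
Proof.
move=> n_ge u v neq_uv.
have ltu := ltn_ord u; have ltv := ltn_ord v.
have duv_gt0 : 0 < dist u v by move: neq_uv; rewrite -val_eqE /dist /=; lia.
pose T := minn (dist u v) (n - dist u v).
have T_gt0 : 0 < T by rewrite /T /dist in duv_gt0 *; lia.
have T_le : 2 * T <= n by rewrite /T; lia.
have [s [s_uniq s_size sP]] := offset_escape T T_gt0.
have LE : w.+1 * L = w * L + L by rewrite mulSn addnC.
have Lgt : w < L by rewrite /L; lia.
(* Either [a <= w] and [2 * T <= n], or [T <= w] and [a <= w * L]; the bound on [n] covers both. *)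
have TaL_lt a : a \in s -> T + a + w * L < n.
  by case/sP=> /offset_leq aL _ /orP; lia.
have Ta_lt a : a \in s -> T + a < n by move/TaL_lt; apply/leq_ltn_trans/leq_addr.
have [g gP] := away_from _ _ _ ltu ltv neq_uv; rewrite -/T in gP.
have gE a : a \in s -> (inord (g a) : 'I_n) = g a :> nat.
  by case/Ta_lt/gP => gn _ _; rewrite inordK.
pose f a : 'I_n := inord (g a).
have fP a : a \in s ->
    (dist v (f a) == a) || (n - dist v (f a) == a)
    /\ (dist u (f a) == T + a) || (n - dist u (f a) == T + a).
  by move=> sa; rewrite gE //; have [_] := gP a (Ta_lt a sa).
(* Equal images force [a = b] or [a + b = n], and [n] is too large to be a sum of two offsets. *)
have f_inj : {in s &, injective f}.
  move=> a b sa sb fab; have [/offset_leq leaL _ _] := sP a sa.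
  have [/offset_leq lebL _ _] := sP b sb.
  have [va _] := fP a sa; have [vb _] := fP b sb; rewrite fab in va.
  by move: (dist v (f b)) va vb => d; lia.
have sub : {subset map f s <= enum (cnbh circulant v :\: cnbh circulant u)}.
  move=> _ /mapP[a sa ->]; have [oa noTa _] := sP a sa; have [va ua] := fP a sa.
  have lta := TaL_lt a sa.
  have big d : w * L < d -> offset d = false.
    by move=> ltd; apply: contraTF ltd => /offset_leq; rewrite leqNgt.
  rewrite mem_enum !inE /= /circ_adj negb_or; apply/andP; split.
    apply/andP; split.
      apply: contraTneq ua => ->; rewrite /dist; lia.
    rewrite negb_and negb_or; apply/orP; right.
    (* The arc of length [T + a] is no offset by the choice of [s], and the other arc is longer than
       every offset. *)
    case/orP: ua => /eqP dE; rewrite ?dE (negbTE noTa) /= big //; lia.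
  have [//|_] /= := eqVneq.
  by case/orP: va => /eqP->; rewrite oa ?orbT.
rewrite cardE (leq_trans s_size) // -(size_map f).
by apply: uniq_leq_size sub; rewrite map_inj_in_uniq.
Qed.

End Circulant.

Theorem theorem2 (R : realType) :
  exists C : R, 0 < C /\
    forall w n : nat, (2 <= w)%N -> Mbound C w <= n%:R ->
      exists G : sgraph 'I_n,
        [/\ graph_connected G,
            strong_nbh_property G w
          & (max_degree G)%:R <=
              Num.max (10 * ln (2 * Mbound C w)) (8 * (w%:R + 1)) + 1].
Proof.
exists 1; split=> // w n w_ge2.
rewrite {1}/Mbound ge_max => /andP[_].
rewrite natr1 -natrX -natrM natr1 ler_nat => n_ge.
case: n n_ge => [|n'] n_ge; first by lia.
exists (circulant w n'); split.
- by apply: circulant_connected; lia.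
(* As [L < 2 * (w + 1)], the required bound is below [8 * (w + 1) ^ 2], hence below [n]. *)
- by apply: circulant_strong; nia.
have deg : (max_degree (circulant w n') <= 4 * w)%N.
  by apply/bigmax_leqP => v _; apply: circulant_degree.
apply: (@le_trans _ _ (8 * w.+1%:R)).
  by rewrite -natrM ler_nat; lia.
by rewrite ler_wpDr // le_max lexx orbT.
Qed.
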